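(* Let $(M,g)$ be a $4$-dimensional Ricci-flat spacetime, let $h$ be a positive smooth function on $M$ which is not constant on any nonempty open subset, and let $\Lambda\in\mathbb{R}$. Suppose that $(M,g,h\,dvol_g)$ is an isotropic solution of the vacuum weighted Einstein field equation, i.e. $h\rho-\operatorname{Hes}_h+(\Delta h+\Lambda)g=0$ and $\nabla h$ is lightlike. Then $(M,g)$ is a $pp$-wave.
   Context: A spacetime is a connected smooth Lorentzian manifold. $\rho$ is the Ricci tensor, $\nabla h$ the gradient of $h$, $\operatorname{Hes}_h(X,Y)=g(\nabla_X\nabla h,Y)$ the Hessian, and $\Delta h=\operatorname{tr}_g\operatorname{Hes}_h$. A vector field $V$ is lightlike if $V\neq 0$ at every point and $g(V,V)=0$. A $pp$-wave is a spacetime admitting a parallel lightlike vector field $V$ such that $R(X,Y)=0$ for all $X,Y\in V^\perp$, where $R$ is the curvature tensor. *)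

(* Defs.v *)
From HB Require Import structures.
From mathcomp Require Import all_boot all_order all_algebra.
From mathcomp Require Import all_classical all_reals all_analysis.
From mathcomp Require Import ring.

Set Implicit Arguments.
Unset Strict Implicit.
Unset Printing Implicit Defensive.

Import Order.TTheory GRing.Theory Num.Theory.
Import numFieldNormedType.Exports.

Local Open Scope classical_set_scope.
Local Open Scope ring_scope.

Section Smooth.
Variables (R : realType) (V W : normedModType R).

(* In finite dimension, [x |-> 'd f x] is C^k iff [x |-> 'D_v f x] is C^k for
   every fixed [v]; this avoids putting a norm on spaces of linear maps. *)
Fixpoint Ck (k : nat) (U : set V) (f : V -> W) : Prop :=
  match k with
  | 0 => forall x, U x -> {for x, continuous f}
  | k'.+1 => (forall x, U x -> differentiable f x)
             /\ forall v, Ck k' U (fun x => 'D_v f x)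
  end.

Definition smooth_on (U : set V) (f : V -> W) : Prop := forall k, Ck k U f.

End Smooth.

(* A manifold carries a (not necessarily maximal) smooth atlas indexed by
  [chart_index]: [phi i] is a homeomorphism from the open set [dom i] onto an
  open set of R^n, with inverse [psi i].  The values of [phi i] outside
  [dom i], and of [psi i] outside [phi i @` dom i], carry no information.
  Vectors of R^n are rows, so linear maps act by right multiplication. *)

Record manifold (R : realType) (n : nat) := Manifold {
  points :> topologicalType ;
  chart_index : Type ;
  dom : chart_index -> set points ;
  phi : chart_index -> points -> 'rV[R]_n ;
  psi : chart_index -> 'rV[R]_n -> points ;
  points_hausdorff : hausdorff_space points ;
  points_second_countable : @second_countable points ;
  dom_open : forall i, open (dom i) ;
  dom_cover : forall p, exists i, dom i p ;
  cod_open : forall i, open (phi i @` dom i) ;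
  phiK : forall i p, dom i p -> psi i (phi i p) = p ;
  phi_continuous : forall i, {within dom i, continuous (phi i)} ;
  psi_continuous : forall i, {within phi i @` dom i, continuous (psi i)} ;
  transition_smooth : forall i j,
    smooth_on (phi i @` (dom i `&` dom j)) (phi j \o psi i)
}.

Section Manifold.
Variables (R : realType) (n : nat) (M : manifold R n).

Definition cod (i : chart_index M) : set 'rV[R]_n := phi i @` dom i.

Definition overlap (i j : chart_index M) : set 'rV[R]_n :=
  phi i @` (dom i `&` dom j).

Definition transition (i j : chart_index M) : 'rV[R]_n -> 'rV[R]_n :=
  phi j \o psi i.

Definition local_rep (h : M -> R) (i : chart_index M) : 'rV[R]_n -> R :=
  h \o psi i.

Definition smooth_function (h : M -> R) : Prop :=
  forall i, smooth_on (cod i) (local_rep h i).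

(* A vector field is given by its component functions in every chart. *)
Definition vector_components := chart_index M -> 'rV[R]_n -> 'rV[R]_n.

Definition smooth_vector_field (V : vector_components) : Prop :=
  (forall i, smooth_on (cod i) (V i)) /\
  (forall i j x, overlap i j x ->
     V j (transition i j x) = V i x *m 'J (transition i j) x).

End Manifold.

Definition minkowski_mx (R : realType) (n : nat) : 'M[R]_n :=
  diag_mx (\row_j (if (j : nat) == 0%N then -1 else 1)).

Definition lorentzian_mx (R : realType) (n : nat) (G : 'M[R]_n) : Prop :=
  G^T = G /\
  exists2 P : 'M[R]_n, P \in unitmx & P *m G *m P^T = minkowski_mx R n.

(* [metric i x] is the matrix g(d_a, d_b) of the metric in the chart [i]. *)
Record spacetime (R : realType) (n : nat) := Spacetime {
  spacetime_manifold :> manifold R n ;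
  spacetime_connected : connected [set: spacetime_manifold] ;
  metric : chart_index spacetime_manifold -> 'rV[R]_n -> 'M[R]_n ;
  metric_smooth : forall i, smooth_on (cod i) (metric i) ;
  metric_lorentzian : forall i x, cod i x -> lorentzian_mx (metric i x) ;
  metric_transition : forall i j x, overlap i j x ->
    let J := 'J (transition i j) x in
    metric i x = J *m metric j (transition i j x) *m J^T
}.

(* [G] is the matrix of the metric as a function of the coordinates; vector
  fields on the chart are functions from R^n to R^n. *)

Section Chart.
Variables (R : realType) (n : nat) (G : 'rV[R]_n -> 'M[R]_n).
Implicit Types (x u v w : 'rV[R]_n) (X Y Z : 'rV[R]_n -> 'rV[R]_n).
Implicit Types (f : 'rV[R]_n -> R).

Definition frame (a : 'I_n) : 'rV[R]_n := delta_mx 0 a.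

Definition partial (a : 'I_n) f x : R := 'D_(frame a) f x.

Definition inner x u v : R := (u *m G x *m v^T) 0 0.

Definition christoffel x (l a b : 'I_n) : R :=
  2^-1 * \sum_m invmx (G x) l m *
    (partial a (fun y => G y b m) x + partial b (fun y => G y a m) x
     - partial m (fun y => G y a b) x).

Definition nabla X Y x : 'rV[R]_n :=
  'D_(X x) Y x +
  \row_l \sum_a \sum_b christoffel x l a b * X x 0 a * Y x 0 b.

Definition bracket X Y x : 'rV[R]_n := 'D_(X x) Y x - 'D_(Y x) X x.

Definition curvature X Y Z x : 'rV[R]_n :=
  nabla X (nabla Y Z) x - nabla Y (nabla X Z) x - nabla (bracket X Y) Z x.

(* [curvature] is tensorial, so its value on tangent vectors at [x] may be
   computed on the extensions with constant components. *)
Definition Riem x u v w : 'rV[R]_n := curvature (cst u) (cst v) (cst w) x.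

(* rho(u, v) = tr (w |-> R(w, u) v) *)
Definition Ricci x u v : R := \sum_a (Riem x (frame a) u v) 0 a.

Definition grad f x : 'rV[R]_n :=
  \row_l \sum_a invmx (G x) l a * partial a f x.

Definition Hes f x u v : R := inner x (nabla (cst u) (grad f) x) v.

Definition trace_g x (B : 'rV[R]_n -> 'rV[R]_n -> R) : R :=
  \sum_a \sum_b invmx (G x) a b * B (frame a) (frame b).

Definition laplacian f x : R := trace_g x (Hes f x).

Lemma partial_sym x a b c :
  (\forall y \near x, (G y)^T = G y) ->
  partial c (fun y => G y a b) x = partial c (fun y => G y b a) x.
Proof.
move=> Gsym; apply: near_eq_derive.
by apply: filterS Gsym => y Gy; rewrite -[in LHS]Gy mxE.
Qed.

(* Together with [christoffel_metric], this shows that [nabla] is the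
   Levi-Civita connection: torsion-free and compatible with the metric. *)
Lemma christoffel_sym x l a b :
  (\forall y \near x, (G y)^T = G y) -> christoffel x l a b = christoffel x l b a.
Proof.
move=> Gsym; rewrite /christoffel; congr (_ * _); apply: eq_bigr => m _.
by rewrite (partial_sym a b) //; congr (_ * (_ - _)); rewrite addrC.
Qed.

Lemma christoffel_metric x c a b :
  (\forall y \near x, (G y)^T = G y) -> G x \in unitmx ->
  partial c (fun y => G y a b) x =
  \sum_m christoffel x m c a * G x m b + \sum_m christoffel x m c b * G x a m.
Proof.
move=> Gsym Gu.
have GC i j : G x i j = G x j i by rewrite -[in LHS](nbhs_singleton Gsym) mxE.
have lower d e k : \sum_m christoffel x m d e * G x m k =
    2^-1 * (partial d (fun y => G y e k) x + partial e (fun y => G y d k) x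
            - partial k (fun y => G y d e) x).
  pose F m := partial d (fun y => G y e m) x + partial e (fun y => G y d m) x
            - partial m (fun y => G y d e) x.
  have -> : \sum_m christoffel x m d e * G x m k =
            2^-1 * \sum_m \sum_p G x k m * invmx (G x) m p * F p.
    rewrite mulr_sumr; apply: eq_bigr => m _.
    rewrite /christoffel -mulrA mulr_suml; congr (_ * _).
    by apply: eq_bigr => p _; rewrite mulrC mulrA (GC m k).
  congr (_ * _); rewrite exchange_big /=.
  have H p : \sum_m G x k m * invmx (G x) m p = (k == p)%:R.
    by have := congr1 (fun A : 'M[R]_n => A k p) (mulmxV Gu); rewrite !mxE.
  under eq_bigr => p _ do rewrite -mulr_suml H.
  rewrite (bigD1 k) //= eqxx mul1r big1 ?addr0 // => p pk.
  by rewrite eq_sym (negbTE pk) mul0r.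
under [X in _ = _ + X]eq_bigr do rewrite (GC a _).
rewrite !lower (partial_sym b a) // (partial_sym c b) // (partial_sym c a) //.
by field.
Qed.

End Chart.

Section Spacetime.
Variables (R : realType) (n : nat) (M : spacetime R n).

Definition gradient (h : M -> R) : vector_components M :=
  fun i => grad (@metric R n M i) (local_rep h i).

Definition lightlike (V : vector_components M) : Prop :=
  forall i x, cod i x ->
    V i x <> 0 /\ inner (@metric R n M i) x (V i x) (V i x) = 0.

Definition parallel (V : vector_components M) : Prop :=
  forall i x u, cod i x -> nabla (@metric R n M i) (cst u) (V i) x = 0.

Definition ricci_flat : Prop :=
  forall i x u v, cod i x -> Ricci (@metric R n M i) x u v = 0.

Definition vacuum_weighted_einstein (h : M -> R) (Lambda : R) : Prop :=
  forall i x u v, cod i x ->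
    let G := @metric R n M i in
    let f := local_rep h i in
    f x * Ricci G x u v - Hes G f x u v
      + (laplacian G f x + Lambda) * inner G x u v = 0.

Definition isotropic_solution (h : M -> R) (Lambda : R) : Prop :=
  vacuum_weighted_einstein h Lambda /\ lightlike (gradient h).

Definition pp_wave : Prop :=
  exists V : vector_components M,
    [/\ smooth_vector_field V, parallel V, lightlike V &
        forall i x u v, cod i x ->
          inner (@metric R n M i) x u (V i x) = 0 ->
          inner (@metric R n M i) x v (V i x) = 0 ->
          forall w, Riem (@metric R n M i) x u v w = 0].

End Spacetime.

(* Main.v *)
From HB Require Import structures.
Require Import Defs.
From mathcomp Require Import all_boot all_order all_algebra.
From mathcomp Require Import all_classical all_reals all_analysis.
From mathcomp Require Import ring lra.
Import Order.TTheory GRing.Theory Num.Theory.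
Import numFieldNormedType.Exports.

(** The parallel null vector field is the gradient [V] of [h].

    Since the Ricci tensor vanishes, the field equation says that the Hessian of
    [h] is a multiple [c] of the metric, with [c = laplacian h + Lambda].
    Differentiating [g (V, V) = 0] in a direction [u] gives [c * g (u, V) = 0], and
    [V] is nowhere zero, so [c = 0] and [V] is parallel ([null_gradient_parallel]).

    A parallel field is annihilated by the curvature, [g (R(u, v) w, V) = 0]
    ([Riem_parallel]).  By the symmetries of the curvature tensor, every component
    with an entry [V] vanishes.  In a null frame [V, U, E, F] the hyperplane
    orthogonal to [V] is spanned by [V], [E] and [F], so only [R(E, F)] has to be
    shown to vanish, and in dimension 4 its remaining components are Ricci
    curvatures ([Ricci_flat_null_hyperplane]).

    The symmetries of the curvature tensor rest on the symmetry of second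
    derivatives ([Schwarz]) and on the smoothness of the Christoffel symbols, hence
    of the inverse of the metric ([smooth_invmx]).  Finally, the gradient satisfies
    the transformation law of vector fields because the differential and the metric
    satisfy theirs ([smooth_gradient]). *)

Set Implicit Arguments.
Unset Strict Implicit.
Unset Printing Implicit Defensive.
Local Open Scope classical_set_scope.
Local Open Scope ring_scope.

(** * Differential calculus of C^k maps *)

Section Calculus.
Variable (R : realType).
Implicit Types V W : normedModType R.

(** [differentiable] refers to the chosen differential ['d f x], so replacing [f]
    by [g] requires identifying the two differentials: that of [f] still gives the
    first order expansion of [g]. *)
Lemma near_eq_differentiable V W (f g : V -> W) x :
  (\near x, f x = g x) -> differentiable f x -> differentiable g x.
Proof.
move=> fg df.
have gd : g \o shift x = cst (g x) + 'd f x +o_ 0 id.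
  apply/eqaddoP => e e0.
  have /diff_locally/eqaddoP/(_ e e0) := df.
  apply: filter_app.
  have : \forall h \near 0, f (h + x) = g (h + x).
    by move: fg; rewrite (near_shift 0) /= subr0.
  apply: filterS => h fgh.
  by rewrite !fctE /= /cst /= -(nbhs_singleton fg) -fgh.
have cd : continuous ('d f x) by move=> y; exact: diff_continuous.
by apply/diff_locallyP; rewrite (diff_unique cd gd).
Qed.

(** The rules of calculus compute a directional derivative only on [U], where
    their hypotheses hold; since [U] is open, such an equality preserves [Ck], and
    this is what the inductions on [k] below need. *)
Lemma Ck_eq V W k (U : set V) (f g : V -> W) :
  open U -> (forall x, U x -> f x = g x) -> Ck k U f -> Ck k U g.
Proof.
move=> oU; elim: k f g => [|k IH] f g fg /=.
  move=> fc x Ux.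
  have fgx : \near x, f x = g x.
    by apply: filterS (open_nbhs_nbhs (conj oU Ux)) => y /fg.
  rewrite /prop_for /continuous_at -fg //.
  exact: cvg_trans (near_eq_cvg fgx) (fc x Ux).
move=> [df Df]; split.
  move=> x Ux; apply: near_eq_differentiable (df x Ux).
  by apply: filterS (open_nbhs_nbhs (conj oU Ux)) => y /fg.
move=> v; apply: IH (Df v) => x Ux; apply: near_eq_derive.
by apply: filterS (open_nbhs_nbhs (conj oU Ux)) => y /fg.
Qed.

Lemma Ck_weaken V W k (U : set V) (f : V -> W) : Ck k.+1 U f -> Ck k U f.
Proof.
elim: k f => [|k IH] f [df Df].
  by move=> x Ux; apply: differentiable_continuous; exact: df.
by split=> // v; apply: IH.
Qed.

Lemma Ck_cst V W k (U : set V) (c : W) : Ck k U (cst c : V -> W).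
Proof.
elim: k c => [|k IH] c; first by move=> x _; exact: cst_continuous.
split=> // v.
have -> : (fun x : V => 'D_v (cst c) x) = cst 0 by apply/funext => x; rewrite derive_cst.
exact: IH.
Qed.

Lemma CkD V W k (U : set V) (f g : V -> W) : open U ->
  Ck k U f -> Ck k U g -> Ck k U (fun x => f x + g x).
Proof.
move=> oU; elim: k f g => [|k IH] f g.
  by move=> fc gc x Ux; apply: continuousD; [exact: fc|exact: gc].
move=> [df Df] [dg Dg]; split.
  by move=> x Ux; apply: differentiableD; [exact: df|exact: dg].
move=> v; apply: Ck_eq oU _ (IH _ _ (Df v) (Dg v)) => x Ux.
by rewrite -deriveD //; apply: diff_derivable; [exact: df|exact: dg].
Qed.

Lemma CkM V k (U : set V) (f g : V -> R) : open U ->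
  Ck k U f -> Ck k U g -> Ck k U (fun x => f x * g x).
Proof.
move=> oU; elim: k f g => [|k IH] f g.
  by move=> fc gc x Ux; apply: continuousM; [exact: fc|exact: gc].
move=> Cf Cg; have [df Df] := Cf; have [dg Dg] := Cg; split.
  by move=> x Ux; apply: differentiableM; [exact: df|exact: dg].
move=> v.
have H1 := IH _ _ (Ck_weaken Cf) (Dg v); have H2 := IH _ _ (Ck_weaken Cg) (Df v).
apply: Ck_eq oU _ (CkD oU H1 H2) => x Ux.
exact/esym/(deriveM (diff_derivable (df x Ux)) (diff_derivable (dg x Ux))).
Qed.

(** The derivative [- f^-2 * 'D_v f] involves only [f^-1] itself, one order of
    differentiability lower, so the induction on [k] closes. *)
Lemma CkV V k (U : set V) (f : V -> R) : open U ->
  (forall x, U x -> f x != 0) -> Ck k U f -> Ck k U (fun x => (f x)^-1).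
Proof.
move=> oU f0; elim: k => [|k IH].
  by move=> fc x Ux; apply: (@continuousV _ _ f); [exact: f0|exact: fc].
move=> Cf; have [df Df] := Cf; split.
  by move=> x Ux; apply: (@differentiableV _ _ f); [exact: df|exact: f0].
move=> v; have Ci := IH (Ck_weaken Cf).
have H := CkM oU (CkM oU (Ck_cst k U (-1 : R)) (CkM oU Ci Ci)) (Df v).
apply: Ck_eq oU _ H => x Ux /=.
rewrite deriveV; [|exact: f0|exact/diff_derivable/df].
by rewrite /GRing.scale /= expr2 invfM mulN1r.
Qed.

Lemma CkZl V W k (U : set V) (f : V -> R) (w : W) : open U ->
  Ck k U f -> Ck k U (fun x => f x *: w).
Proof.
move=> oU; elim: k f => [|k IH] f.
  by move=> fc x Ux; apply: cvgZr_tmp; exact: fc.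
move=> [df Df]; split; first by move=> x /df; exact: differentiableZl.
move=> v; apply: Ck_eq oU _ (IH _ (Df v)) => x Ux.
rewrite (deriveE _ (df x Ux)) deriveE; last exact/differentiableZl/df.
by rewrite (diffZl w (df x Ux)).
Qed.

Lemma Ck_sum V W k (U : set V) (I : Type) (r : seq I) (f : I -> V -> W) :
  open U -> (forall i, Ck k U (f i)) -> Ck k U (fun x => \sum_(i <- r) f i x).
Proof.
move=> oU Cf; elim: r => [|i r IH].
  by apply: Ck_eq oU _ (Ck_cst k U (0 : W)) => x _; rewrite big_nil.
by apply: Ck_eq oU _ (CkD oU (Cf i) IH) => x _; rewrite big_cons.
Qed.

Lemma Ck_prod V k (U : set V) (I : Type) (r : seq I)
    (f : I -> V -> R) : open U ->
  (forall i, Ck k U (f i)) -> Ck k U (fun x => \prod_(i <- r) f i x).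
Proof.
move=> oU Cf; elim: r => [|i r IH].
  by apply: Ck_eq oU _ (Ck_cst k U (1 : R)) => x _; rewrite big_nil.
by apply: Ck_eq oU _ (CkM oU (Cf i) IH) => x _; rewrite big_cons.
Qed.

Lemma differentiable_entry V m n (A : V -> 'M[R]_(m, n)) x i j :
  differentiable A x -> differentiable (fun y => A y i j) x.
Proof.
move=> dA; apply: (@differentiable_comp _ _ _ _ A (fun B : 'M[R]_(m, n) => B i j)) => //.
exact: differentiable_coord.
Qed.

Lemma differentiable_matrix V m n (A : V -> 'M[R]_(m, n)) x :
  (forall i j, differentiable (fun y => A y i j) x) -> differentiable A x.
Proof.
move=> dA.
have -> : A = \sum_(i < m) \sum_(j < n) (fun y => A y i j *: delta_mx i j).
  apply/funext => y; rewrite [LHS]matrix_sum_delta fct_sumE.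
  by apply: eq_bigr => i _; rewrite fct_sumE.
apply: differentiable_sum => i; apply: differentiable_sum => j.
exact: differentiableZl.
Qed.

Lemma derive_entry V m n (A : V -> 'M[R]_(m, n)) x v i j :
  differentiable A x -> ('D_v A x) i j = 'D_v (fun y => A y i j) x.
Proof. by move=> dA; rewrite derive_mx ?mxE //; exact: diff_derivable. Qed.

Lemma Ck_entry V k (U : set V) m n (A : V -> 'M[R]_(m, n)) i j : open U ->
  Ck k U A -> Ck k U (fun x => A x i j).
Proof.
move=> oU; elim: k A => [|k IH] A.
  move=> cA x Ux.
  by apply: (@continuous_comp _ _ _ A (fun B : 'M[R]_(m, n) => B i j));
    [exact: cA|exact: coord_continuous].
move=> [dA DA]; split; first by move=> x /dA; exact: differentiable_entry.
move=> v; apply: Ck_eq oU _ (IH _ (DA v)) => x Ux.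
by rewrite derive_entry //; exact: dA.
Qed.

(** A matrix is the finite sum of its entries times constant matrices, so no
    comparison between the norm of a matrix and those of its entries is needed. *)
Lemma Ck_matrix V k (U : set V) m n (A : V -> 'M[R]_(m, n)) : open U ->
  (forall i j, Ck k U (fun x => A x i j)) -> Ck k U A.
Proof.
move=> oU CA.
have -> : A = fun y => \sum_(i < m) \sum_(j < n) A y i j *: delta_mx i j.
  by apply/funext => y; exact: matrix_sum_delta.
by do 2![apply: Ck_sum => // ?]; exact: CkZl.
Qed.

End Calculus.

(** * Symmetry of mixed derivatives *)

Section Schwarz.
Variables (R : realType) (V : normedModType R).
Implicit Types (f : V -> R) (U : set V).

(** Restricting to a line turns a directional derivative into an ordinary one,
    because the two difference quotients are the same function. *)
Lemma is_derive_line f x u (s : R) : derivable f (x + s *: u) u ->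
  is_derive s 1 (fun t => f (x + t *: u)) ('D_u f (x + s *: u)).
Proof.
have E : (fun h : R => h^-1 *: (((fun t => f (x + t *: u)) \o shift s) (h *: 1)
              - f (x + s *: u)))
       = (fun h => h^-1 *: ((f \o shift (x + s *: u)) (h *: u) - f (x + s *: u))).
  apply/funext => h /=; congr (_ *: (f _ - _)).
  by rewrite [h *: 1]mulr1 scalerDl addrCA.
by move=> df; split; rewrite /derivable /derive E.
Qed.

Lemma MVT_line f x u (t : R) : 0 < t ->
  (forall s, 0 <= s <= t -> derivable f (x + s *: u) u) ->
  exists2 c, 0 < c < t & f (x + t *: u) - f x = 'D_u f (x + c *: u) * t.
Proof.
move=> t0 df.
have dg s : s \in `]0, t[ ->
    is_derive s 1 (fun t => f (x + t *: u)) ('D_u f (x + s *: u)).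
  by rewrite in_itv /= => /andP[/ltW s0 /ltW st]; apply/is_derive_line/df/andP.
have cg : {within `[0, t], continuous (fun t => f (x + t *: u))}.
  apply: derivable_within_continuous => s; rewrite in_itv /= => /df.
  by move=> /is_derive_line [].
have [c] := MVT t0 dg cg.
rewrite in_itv /= scale0r addr0 subr0 => ct E; by exists c.
Qed.

(** The mean value theorem is applied to the increment
    [fun y => f (y + t *: v) - f y] along [u], then to ['D_u f] along [v]. *)
Lemma second_difference f x u v (t : R) U : 0 < t -> Ck 2 U f ->
  (forall r s : R, 0 <= r <= t -> 0 <= s <= t -> U (x + r *: u + s *: v)) ->
  exists c d, [/\ 0 < c < t, 0 < d < t &
    f (x + t *: u + t *: v) - f (x + t *: u) - f (x + t *: v) + f x
    = 'D_v (fun y => 'D_u f y) (x + c *: u + d *: v) * t * t].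
Proof.
move=> t0 [df /(_ u)[dDf _]] tU.
have tt : 0 <= t <= t by apply/andP; split=> //; exact: ltW.
have z : (0 : R) <= 0 <= t by apply/andP; split=> //; exact: ltW.
pose g y := f (y + t *: v) - f y.
have Ug s : 0 <= s <= t -> U (x + s *: u + t *: v) /\ U (x + s *: u).
  by move=> st; split; [exact: tU|rewrite -[x + _]addr0 -(scale0r v); exact: tU].
have sh y : U (y + t *: v) -> is_derive y u (fun z => f (z + t *: v)) ('D_u f (y + t *: v)).
  move=> Uy; have d := diff_derivable (v := u) (df _ Uy).
  have E : (fun h : R => h^-1 *: (((fun z => f (z + t *: v)) \o shift y) (h *: u)
              - f (y + t *: v)))
       = (fun h => h^-1 *: ((f \o shift (y + t *: v)) (h *: u) - f (y + t *: v))).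
    by apply/funext => h /=; rewrite addrA.
  by split; rewrite /derivable /derive E.
have dg y : U (y + t *: v) -> U y ->
    is_derive y u g ('D_u f (y + t *: v) - 'D_u f y).
  by move=> Uyt Uy; apply: is_deriveB; [exact: sh|exact/derivableP/diff_derivable/df].
have [c ct Ec] : exists2 c, 0 < c < t & g (x + t *: u) - g x = 'D_u g (x + c *: u) * t.
  by apply: MVT_line => // s /Ug[? ?]; have [] := dg (x + s *: u).
have ct' : 0 <= c <= t by case/andP: ct => /ltW -> /ltW ->.
have [d dt Ed] := MVT_line t0
  (fun s st => diff_derivable (v := v) (dDf _ (tU c s ct' st))).
exists c, d; split=> //.
have [Uc1 Uc2] := Ug c ct'.
move: Ec; rewrite (@derive_val _ _ _ _ _ _ _ (dg _ Uc1 Uc2)) Ed => <-.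
by rewrite /g; ring.
Qed.

(** The second difference of [f] over a small parallelogram with sides [t *: u]
    and [t *: v] does not depend on the order of the sides, and by
    [second_difference] it equals [t * t] times either mixed derivative at some
    point of the parallelogram; continuity of both then gives equality at [x]. *)
Lemma Schwarz f x u v U : open U -> U x -> Ck 2 U f ->
  'D_u (fun y => 'D_v f y) x = 'D_v (fun y => 'D_u f y) x.
Proof.
move=> oU Ux Cf.
have [_ /(_ v)[_ /(_ u)/(_ x Ux)]] := Cf; set a := (X in {for x, continuous X}) => ca.
have [_ /(_ u)[_ /(_ v)/(_ x Ux)]] := Cf; set b := (X in {for x, continuous X}) => cb.
change (a x = b x).
apply/eqP; rewrite -subr_eq0 -normr_le0; apply/ler_addgt0Pr => e e0; rewrite add0r.
have e20 : 0 < e / 2 by rewrite divr_gt0.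
have na : \forall y \near x, `|a x - a y| < e / 2.
  by have /cvgrPdist_lt := ca; apply.
have nb : \forall y \near x, `|b x - b y| < e / 2.
  by have /cvgrPdist_lt := cb; apply.
have nU : \forall y \near x, U y by exact: open_nbhs_nbhs.
have [r /= r0 rN] := (nbhs_ballP _ _).1 (filterI nU (filterI na nb)).
(* The parallelogram of side [t] must fit in the ball of radius [r]; the 1 in [K]
   allows for [u = v = 0]. *)
pose K := `|u| + `|v| + 1.
have K0 : 0 < K by rewrite /K ltr_wpDl // addr_ge0.
pose t := r / 2 / K.
have t0 : 0 < t by rewrite /t !divr_gt0.
have N c d : 0 <= c <= t -> 0 <= d <= t -> ball x r (x + c *: u + d *: v).
  move=> /andP[c0 ct] /andP[d0 dt]; rewrite -ball_normE /=.
  rewrite -addrA opprD addrA subrr sub0r normrN.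
  apply: (le_lt_trans (ler_normD _ _)); rewrite !normrZ !ger0_norm //.
  apply: (@le_lt_trans _ _ (t * K)).
    rewrite /K !mulrDr mulr1 -[leLHS]addr0; apply: lerD; last exact: ltW.
    by apply: lerD; apply: ler_wpM2r.
  by rewrite /t divfK ?gt_eqF // ltr_pdivrMr // ltr_pMr // ltr1n.
have NU c d : 0 <= c <= t -> 0 <= d <= t -> U (x + c *: u + d *: v).
  by move=> ct dt; have [] := rN _ (N c d ct dt).
have NU' c d : 0 <= c <= t -> 0 <= d <= t -> U (x + c *: v + d *: u).
  by move=> ct dt; rewrite addrAC; exact: NU.
have W (c : R) : 0 < c < t -> 0 <= c <= t by move=> /andP[/ltW -> /ltW ->].
have [c [d [/W ct /W dt E]]] := second_difference t0 Cf NU.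
have [c' [d' [/W ct' /W dt' E']]] := second_difference t0 Cf NU'.
have {E E'} E : b (x + c *: u + d *: v) = a (x + d' *: u + c' *: v).
  rewrite [X in a X]addrAC.
  apply: (mulIf (lt0r_neq0 t0)); apply: (mulIf (lt0r_neq0 t0)).
  apply: etrans (esym E) _; apply: etrans _ E'.
  by rewrite [x + t *: v + _]addrAC; ring.
have [_ [_ Hb]] := rN _ (N _ _ ct dt); have [_ [Ha _]] := rN _ (N _ _ dt' ct').
rewrite {}E in Hb; move: Hb Ha; set z := a (x + _ + _).
move: (a x) (b x) z; clear; move=> ax bx z Hb Ha.
have -> : ax - bx = (ax - z) - (bx - z) by ring.
rewrite (splitr e); apply: (le_trans (ler_normB _ _)).
exact: lerD (ltW Ha) (ltW Hb).
Qed.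

End Schwarz.

(** * Smooth fields of matrices *)

Section SmoothMatrices.
Variables (R : realType) (V : normedModType R) (U : set V).
Hypothesis oU : open U.

Lemma differentiable_mulmx m n p (A : V -> 'M[R]_(m, n)) (B : V -> 'M[R]_(n, p)) x :
  differentiable A x -> differentiable B x -> differentiable (fun y => A y *m B y) x.
Proof.
move=> dA dB; apply: differentiable_matrix => i j.
have -> : (fun y => (A y *m B y) i j) = \sum_k (fun y => A y i k * B y k j).
  by apply/funext => y; rewrite mxE fct_sumE.
by apply: differentiable_sum => k; apply: differentiableM; exact: differentiable_entry.
Qed.

Lemma derive_mulmx m n p (A : V -> 'M[R]_(m, n)) (B : V -> 'M[R]_(n, p)) x v :
  differentiable A x -> differentiable B x ->
  'D_v (fun y => A y *m B y) x = 'D_v A x *m B x + A x *m 'D_v B x.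
Proof.
move=> dA dB; apply/matrixP => i j.
have dAB k : is_derive x v (fun y => A y i k * B y k j)
    (A x i k * 'D_v (fun y => B y k j) x + B x k j * 'D_v (fun y => A y i k) x).
  by apply: is_deriveM; apply/derivableP/diff_derivable/differentiable_entry.
rewrite (derive_entry _ _ _ (differentiable_mulmx dA dB)).
have -> : (fun y => (A y *m B y) i j) = \sum_k (fun y => A y i k * B y k j).
  by apply/funext => y; rewrite mxE fct_sumE.
rewrite derive_sum; last by move=> k; have [] := dAB k.
rewrite !mxE -big_split /=; apply: eq_bigr => k _.
rewrite (@derive_val _ _ _ _ _ _ _ (dAB k)) (derive_entry _ _ _ dA) (derive_entry _ _ _ dB).
by rewrite addrC; congr (_ + _); exact: mulrC.
Qed.

Lemma differentiable_trmx m n (A : V -> 'M[R]_(m, n)) x :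
  differentiable A x -> differentiable (fun y => (A y)^T) x.
Proof.
move=> dA; apply: differentiable_matrix => i j.
have -> : (fun y => (A y)^T i j) = (fun y => A y j i).
  by apply/funext => y; rewrite mxE.
exact: differentiable_entry.
Qed.

Lemma derive_trmx m n (A : V -> 'M[R]_(m, n)) x v : differentiable A x ->
  'D_v (fun y => (A y)^T) x = ('D_v A x)^T.
Proof.
move=> dA; apply/matrixP => i j.
rewrite (derive_entry _ _ _ (differentiable_trmx dA)) mxE (derive_entry _ _ _ dA).
suff -> : (fun y => (A y)^T i j) = (fun y => A y j i) by [].
by apply/funext => y; rewrite mxE.
Qed.

Lemma smooth_entry m n (A : V -> 'M[R]_(m, n)) i j :
  smooth_on U A -> smooth_on U (fun x => A x i j).
Proof. by move=> sA k; exact: Ck_entry. Qed.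

Lemma smooth_mulmx m n p (A : V -> 'M[R]_(m, n)) (B : V -> 'M[R]_(n, p)) :
  smooth_on U A -> smooth_on U B -> smooth_on U (fun x => A x *m B x).
Proof.
move=> sA sB k; apply: Ck_matrix => // i j.
have H : Ck k U (fun x => \sum_l A x i l * B x l j).
  by apply: Ck_sum => // l; apply: CkM => //; exact: smooth_entry.
by apply: Ck_eq oU _ H => x _; rewrite mxE.
Qed.

Lemma smooth_trmx m n (A : V -> 'M[R]_(m, n)) :
  smooth_on U A -> smooth_on U (fun x => (A x)^T).
Proof.
move=> sA k; apply: Ck_matrix => // i j.
by apply: Ck_eq oU _ (smooth_entry j i sA k) => x _; rewrite mxE.
Qed.

(** The hypothesis is on the entries, so that minors are covered as well. *)
Lemma smooth_det n (A : V -> 'M[R]_n) :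
  (forall i j, smooth_on U (fun x => A x i j)) -> smooth_on U (fun x => \det (A x)).
Proof.
move=> sA k; apply: Ck_sum => // s; apply: CkM => //; first exact: Ck_cst.
by apply: Ck_prod => // i; exact: sA.
Qed.

(** Cramer's rule: the entries of the inverse are cofactors divided by the
    determinant. *)
Lemma smooth_invmx n (A : V -> 'M[R]_n) : smooth_on U A ->
  (forall x, U x -> A x \in unitmx) -> smooth_on U (fun x => invmx (A x)).
Proof.
move=> sA uA k; apply: Ck_matrix => // i j.
have cof : smooth_on U (fun x => cofactor (A x) j i).
  move=> l; apply: CkM => //; first exact: Ck_cst.
  apply: smooth_det => i' j' l'.
  by apply: Ck_eq oU _ (smooth_entry (lift j i') (lift i j') sA l') => x _; rewrite !mxE.
have dA := smooth_det (fun i j => smooth_entry i j sA).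
have dA0 x : U x -> \det (A x) != 0 by move=> /uA; rewrite unitmxE unitfE.
apply: Ck_eq oU _ (CkM oU (CkV oU dA0 (dA k)) (cof k)) => x Ux.
by rewrite /invmx uA // [RHS]mxE [X in _ = _ * X]mxE.
Qed.

Lemma smooth_differentiable (W : normedModType R) (f : V -> W) x :
  smooth_on U f -> U x -> differentiable f x.
Proof. by move=> /(_ 1%N)[df _]; exact: df. Qed.

Lemma smooth_derive (W : normedModType R) (f : V -> W) v :
  smooth_on U f -> smooth_on U (fun x => 'D_v f x).
Proof. by move=> sf k; have [_] := sf k.+1; exact. Qed.

Lemma open_near (P : V -> Prop) x : U x -> (forall y, U y -> P y) -> \forall y \near x, P y.
Proof. by move=> Ux UP; apply: filterS (open_nbhs_nbhs (conj oU Ux)). Qed.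

End SmoothMatrices.

(** * The Levi-Civita connection and its curvature in a chart *)

Section ChartGeometry.
Variables (R : realType) (n : nat) (G : 'rV[R]_n -> 'M[R]_n).
Variable U : set 'rV[R]_n.
Hypothesis oU : open U.
Hypothesis sG : smooth_on U G.
Hypothesis symG : forall x, U x -> (G x)^T = G x.
Hypothesis unitG : forall x, U x -> G x \in unitmx.
Implicit Types (x u v w z : 'rV[R]_n) (Y Z : 'rV[R]_n -> 'rV[R]_n).

(** The connection 1-form evaluated on [u].  With rows as vectors it acts on the
    right: [Y *m connection_mx x u] is the zeroth order part of the covariant
    derivative of [Y] along [u]. *)
Definition connection_mx x u : 'M[R]_n :=
  \matrix_(b, l) \sum_a christoffel G x l a b * u 0 a.

Lemma connection_mx_linear x a u v :
  connection_mx x (a *: u + v) = a *: connection_mx x u + connection_mx x v.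
Proof.
apply/matrixP => i j; rewrite !mxE mulr_sumr -big_split /=.
by apply: eq_bigr => c _; rewrite !mxE; ring.
Qed.

Lemma nablaE X Y x :
  nabla G X Y x = 'D_(X x) Y x + Y x *m connection_mx x (X x).
Proof.
congr (_ + _); apply/rowP => l; rewrite !mxE exchange_big /=.
apply: eq_bigr => b _; rewrite mxE mulr_sumr.
by apply: eq_bigr => a _; ring.
Qed.

Lemma nabla_cst u v x : nabla G (cst u) (cst v) x = v *m connection_mx x u.
Proof. by rewrite nablaE derive_cst add0r. Qed.

Lemma nabla0 X Y x : X x = 0 -> nabla G X Y x = 0.
Proof.
move=> X0; rewrite nablaE X0 derive0 add0r.
have -> : connection_mx x 0 = 0.
  by apply/matrixP => i j; rewrite !mxE big1 // => a _; rewrite mxE mulr0.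
by rewrite mulmx0.
Qed.

Lemma near_eq_nabla X Y Z x : (\near x, Y x = Z x) -> nabla G X Y x = nabla G X Z x.
Proof. by move=> YZ; rewrite !nablaE (near_eq_derive _ YZ) (nbhs_singleton YZ). Qed.

Lemma nabla_linear X a Y Z x : differentiable Y x -> differentiable Z x ->
  nabla G X (fun y => a *: Y y + Z y) x = a *: nabla G X Y x + nabla G X Z x.
Proof.
move=> dY dZ; have Y' := diff_derivable (v := X x) dY.
have Z' := diff_derivable (v := X x) dZ.
rewrite !nablaE mulmxDl -scalemxAl scalerDr.
have -> : 'D_(X x) (fun y => a *: Y y + Z y) x = a *: 'D_(X x) Y x + 'D_(X x) Z x.
  by rewrite -(deriveZ a Y'); exact: deriveD (derivableZ Y') Z'.
by rewrite addrACA.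
Qed.

Lemma nabla_linear_dir a u v Y x : differentiable Y x ->
  nabla G (cst (a *: u + v)) Y x =
  a *: nabla G (cst u) Y x + nabla G (cst v) Y x.
Proof.
move=> dY; rewrite !nablaE /cst connection_mx_linear !deriveE // linearP.
by rewrite mulmxDr -scalemxAr scalerDr addrACA.
Qed.

Let near_symG x : U x -> \forall y \near x, (G y)^T = G y.
Proof. by move=> Ux; exact: open_near Ux symG. Qed.

(** Constant fields commute, so this is the vanishing of the torsion. *)
Lemma nabla_cst_sym u v x : U x ->
  nabla G (cst u) (cst v) x = nabla G (cst v) (cst u) x.
Proof.
move=> Ux; rewrite !nabla_cst; apply/rowP => l; rewrite !mxE.
under eq_bigr do rewrite mxE mulr_sumr.
under [RHS]eq_bigr do rewrite mxE mulr_sumr.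
rewrite exchange_big; apply: eq_bigr => a _; apply: eq_bigr => b _.
by rewrite (christoffel_sym l a b (near_symG Ux)); ring.
Qed.

(** Metric compatibility in matrix form; it is what makes the product rule of
    [derive_inner] come out in terms of covariant derivatives. *)
Lemma derive_metric u x : U x ->
  'D_u G x = connection_mx x u *m G x + G x *m (connection_mx x u)^T.
Proof.
move=> Ux; have dG := smooth_differentiable sG Ux.
apply/matrixP => i j; rewrite derive_entry // deriveE; last exact: differentiable_entry.
rewrite [in LHS](row_sum_delta u) linear_sum !mxE.
under [X in _ = X + _]eq_bigr do rewrite mxE mulr_suml.
under [X in _ = _ + X]eq_bigr do rewrite !mxE mulr_sumr.
rewrite exchange_big /= [X in _ = _ + X]exchange_big -big_split /=.
apply: eq_bigr => c _; rewrite linearZ /= -deriveE; last exact: differentiable_entry.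
have := christoffel_metric c i j (near_symG Ux) (unitG Ux).
rewrite /partial /frame => ->.
rewrite [LHS]mulrDr !mulr_sumr.
by congr (_ + _); apply: eq_bigr => m _; ring.
Qed.

Lemma innerE x u v : inner G x u v = \sum_b (u *m G x) 0 b * v 0 b.
Proof. by rewrite /inner mxE; apply: eq_bigr => b _; rewrite [v^T _ _]mxE. Qed.

Lemma inner_sym x u v : U x -> inner G x u v = inner G x v u.
Proof.
move=> Ux; have <- : (v *m G x *m u^T)^T 0 0 = inner G x v u by rewrite mxE.
by rewrite 2!trmx_mul trmxK symG // mulmxA.
Qed.

Lemma inner_linearl x a u v w :
  inner G x (a *: u + v) w = a * inner G x u w + inner G x v w.
Proof. by rewrite /inner !mulmxDl -!scalemxAl !mxE. Qed.

Lemma inner_linearr x a u v w :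
  inner G x w (a *: u + v) = a * inner G x w u + inner G x w v.
Proof. by rewrite /inner linearP /= mulmxDr -scalemxAr !mxE. Qed.

Lemma inner0r x u : inner G x u 0 = 0.
Proof. by rewrite /inner trmx0 mulmx0 mxE. Qed.

Lemma innerBl x u v w : inner G x (u - v) w = inner G x u w - inner G x v w.
Proof. by rewrite -[u - v]addrC -scaleN1r inner_linearl mulN1r addrC. Qed.

Lemma innerBr x u v w : inner G x w (u - v) = inner G x w u - inner G x w v.
Proof. by rewrite -[u - v]addrC -scaleN1r inner_linearr mulN1r addrC. Qed.

Lemma inner_nondegenerate x u : U x -> (forall v, inner G x u v = 0) -> u = 0.
Proof.
move=> Ux u0; apply: (can_inj (mulmxK (unitG Ux))); rewrite mul0mx.
apply/rowP => j; rewrite [RHS]mxE -(u0 (delta_mx 0 j)) innerE (bigD1 j) //=.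
rewrite [X in _ * X]mxE !eqxx mulr1 big1 ?addr0 // => b bj.
by rewrite [X in _ * X]mxE (negbTE bj) andbF mulr0.
Qed.

Lemma smooth_connection u : smooth_on U (fun x => connection_mx x u).
Proof.
have dG a b m : smooth_on U (fun x => partial a (fun y => G y b m) x).
  exact/smooth_derive/smooth_entry.
move=> k; apply: Ck_matrix => // b l.
have H : Ck k U (fun x => \sum_a christoffel G x l a b * u 0 a).
  apply: Ck_sum => // a; apply: CkM => //; last exact: Ck_cst.
  apply: CkM => //; first exact: Ck_cst.
  apply: Ck_sum => // m; apply: CkM => //.
    exact: (smooth_entry oU l m (smooth_invmx oU sG unitG)).
  apply: CkD => //; first by apply: CkD => //; exact: dG.
  have := CkM oU (Ck_cst k U (-1 : R)) (dG m a b k).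
  by apply: Ck_eq => // x _; rewrite /cst mulN1r.
by apply: Ck_eq oU _ H => x _; rewrite mxE.
Qed.

Lemma smooth_nabla u Y : smooth_on U Y -> smooth_on U (nabla G (cst u) Y).
Proof.
move=> sY k.
have := CkD oU (smooth_derive u sY k) (smooth_mulmx oU sY (smooth_connection u) k).
by apply: Ck_eq => // x _; rewrite nablaE.
Qed.

Lemma smooth_inner Y Z : smooth_on U Y -> smooth_on U Z ->
  smooth_on U (fun x => inner G x (Y x) (Z x)).
Proof.
by move=> sY sZ; apply/smooth_entry/smooth_mulmx/smooth_trmx => //; exact: smooth_mulmx.
Qed.

Lemma derive_inner u Y Z x : U x -> differentiable Y x -> differentiable Z x ->
  'D_u (fun y => inner G y (Y y) (Z y)) x =
  inner G x (nabla G (cst u) Y x) (Z x) + inner G x (Y x) (nabla G (cst u) Z x).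
Proof.
move=> Ux dY dZ; have dG := smooth_differentiable sG Ux.
have dYG := differentiable_mulmx dY dG; have dZT := differentiable_trmx dZ.
rewrite /inner -(derive_entry _ _ _ (differentiable_mulmx dYG dZT)).
rewrite (derive_mulmx _ dYG dZT) (derive_mulmx _ dY dG) (derive_trmx _ dZ).
rewrite derive_metric // !nablaE /cst.
have entryD (A B : 'M[R]_1) : (A + B) 0 0 = A 0 0 + B 0 0 by rewrite mxE.
rewrite [(_ + _)^T]raddfD /= !trmx_mul !(mulmxDl, mulmxDr) !mulmxA !entryD.
by ring.
Qed.

(** Constant fields have zero bracket, so only the commutator of covariant
    derivatives remains. *)
Lemma RiemE x u v w : Riem G x u v w =
  nabla G (cst u) (nabla G (cst v) (cst w)) x -
  nabla G (cst v) (nabla G (cst u) (cst w)) x.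
Proof.
rewrite /Riem /curvature (nabla0 (X := bracket _ _)) ?subr0 //.
by rewrite /bracket !derive_cst subr0.
Qed.

Lemma smooth_cst (W : normedModType R) (c : W) : smooth_on U (cst c : 'rV[R]_n -> W).
Proof. by move=> k; exact: Ck_cst. Qed.

(** Second derivatives of the function [inner y (Y y) (Z y)] commute.  Expanding
    them by [derive_inner], the cross terms are symmetric in [u] and [v], and the
    commutators are what is left.  With both fields constant this gives the
    skew-symmetry of [Riem]; with [Z] parallel it gives [Riem_parallel]. *)
Lemma curvature_skew u v Y Z x : U x -> smooth_on U Y -> smooth_on U Z ->
  inner G x (nabla G (cst u) (nabla G (cst v) Y) x -
             nabla G (cst v) (nabla G (cst u) Y) x) (Z x) +
  inner G x (Y x) (nabla G (cst u) (nabla G (cst v) Z) x -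
             nabla G (cst v) (nabla G (cst u) Z) x) = 0.
Proof.
move=> Ux sY sZ; pose f y := inner G y (Y y) (Z y).
have D2 a b : 'D_a (fun y => 'D_b f y) x =
    inner G x (nabla G (cst a) (nabla G (cst b) Y) x) (Z x)
  + inner G x (nabla G (cst b) Y x) (nabla G (cst a) Z x)
  + (inner G x (nabla G (cst a) Y x) (nabla G (cst b) Z x)
  + inner G x (Y x) (nabla G (cst a) (nabla G (cst b) Z) x)).
  have dn W c : smooth_on U W -> differentiable (nabla G (cst c) W) x.
    by move=> sW; exact: smooth_differentiable (smooth_nabla c sW) Ux.
  have dY := smooth_differentiable sY Ux; have dZ := smooth_differentiable sZ Ux.
  rewrite -(derive_inner _ Ux (dn _ _ sY) dZ) -(derive_inner _ Ux dY (dn _ _ sZ)).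
  rewrite -deriveD; first last.
  - apply: diff_derivable; apply: (smooth_differentiable _ Ux).
    exact/smooth_inner/smooth_nabla.
  - apply: diff_derivable; apply: (smooth_differentiable _ Ux).
    by apply/smooth_inner => //; exact/smooth_nabla.
  apply: near_eq_derive; apply: open_near Ux _ => // y Uy.
  by rewrite /f derive_inner //; exact: smooth_differentiable Uy.
have := Schwarz u v oU Ux (smooth_inner sY sZ 2); rewrite -/f !D2 !innerBl !innerBr.
by move=> E; apply/eqP; move/eqP: E; rewrite -subr_eq0; apply: etrans; congr (_ == _); ring.
Qed.

Lemma Riem_skew x u v w z : U x ->
  inner G x (Riem G x u v w) z = - inner G x (Riem G x u v z) w.
Proof.
move=> Ux; rewrite [in RHS]inner_sym //; apply/eqP; rewrite -addr_eq0 !RiemE.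
by rewrite (@curvature_skew u v (cst w) (cst z)) //; exact: smooth_cst.
Qed.

Lemma Riem_antisym x u v w : Riem G x u v w = - Riem G x v u w.
Proof. by rewrite !RiemE opprB. Qed.

Lemma Riem_parallel x u v w Z : U x -> smooth_on U Z ->
  (forall y a, U y -> nabla G (cst a) Z y = 0) ->
  inner G x (Riem G x u v w) (Z x) = 0.
Proof.
move=> Ux sZ pZ; have := curvature_skew u v Ux (smooth_cst w) sZ.
have nn a b : nabla G (cst a) (nabla G (cst b) Z) x = 0.
  rewrite (@near_eq_nabla _ _ (cst 0)); last by apply: open_near Ux _ => // y; exact: pZ.
  by rewrite nabla_cst mul0mx.
move=> E; rewrite RiemE; apply: etrans E; rewrite [X in _ = _ + X](_ : _ = 0) ?addr0 //.
by rewrite (nn u v) (nn v u) subrr inner0r.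
Qed.

(** Exchanging the two inner arguments by vanishing torsion makes the six second
    covariant derivatives cancel in pairs. *)
Lemma Riem_Bianchi x u v w : U x ->
  Riem G x u v w + Riem G x v w u + Riem G x w u v = 0.
Proof.
move=> Ux; have S a b c : nabla G (cst a) (nabla G (cst b) (cst c)) x =
    nabla G (cst a) (nabla G (cst c) (cst b)) x.
  by apply: near_eq_nabla; apply: open_near Ux _ => // y; exact: nabla_cst_sym.
rewrite !RiemE (S u v w) (S v u w) (S w v u).
have telescope (a b c : 'rV[R]_n) : a - b + (b - c) + (c - a) = 0.
  by rewrite !subrKA subrr.
exact: telescope.
Qed.

Let differentiable_nabla_cst x u w : U x -> differentiable (nabla G (cst u) (cst w)) x.
Proof. by apply: smooth_differentiable; exact/smooth_nabla/smooth_cst. Qed.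

Lemma Riem_linear3 x u v a w z : U x ->
  Riem G x u v (a *: w + z) = a *: Riem G x u v w + Riem G x u v z.
Proof.
move=> Ux; have E b : nabla G (cst b) (cst (a *: w + z)) =
    (fun y => a *: nabla G (cst b) (cst w) y + nabla G (cst b) (cst z) y).
  apply/funext => y; apply: (@nabla_linear (cst b) a (cst w) (cst z) y);
  exact: differentiable_cst.
have d b c := differentiable_nabla_cst b c Ux.
have N c b : nabla G (cst c) (nabla G (cst b) (cst (a *: w + z))) x =
    a *: nabla G (cst c) (nabla G (cst b) (cst w)) x +
    nabla G (cst c) (nabla G (cst b) (cst z)) x.
  by rewrite E; exact: nabla_linear (d _ _) (d _ _).
by rewrite !RiemE (N u v) (N v u) scalerBr opprD addrACA.
Qed.

Lemma Riem_linear1 x a u v w z : U x ->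
  Riem G x (a *: u + v) w z = a *: Riem G x u w z + Riem G x v w z.
Proof.
move=> Ux; have E : nabla G (cst (a *: u + v)) (cst z) =
    (fun y => a *: nabla G (cst u) (cst z) y + nabla G (cst v) (cst z) y).
  by apply/funext => y; exact: nabla_linear_dir (differentiable_cst _ _).
have d b c := differentiable_nabla_cst b c Ux.
rewrite !RiemE E (nabla_linear_dir _ _ _ (d _ _)) (nabla_linear _ _ (d _ _) (d _ _)).
by rewrite scalerBr opprD addrACA.
Qed.

Lemma inner_grad f x v : U x -> differentiable f x ->
  inner G x (grad G f x) v = 'D_v f x.
Proof.
move=> Ux df; rewrite innerE.
have -> : grad G f x = (\row_b partial b f x) *m invmx (G x).
  apply/rowP => l; rewrite !mxE; apply: eq_bigr => a _.
  by rewrite mxE mulrC -[in LHS](symG Ux) -trmx_inv mxE.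
rewrite (mulmxKV (unitG Ux)).
rewrite deriveE // [in RHS](row_sum_delta v) linear_sum; apply: eq_bigr => b _.
by rewrite linearZ /= mxE /partial deriveE // mulrC.
Qed.

Lemma smooth_grad f : smooth_on U f -> smooth_on U (grad G f).
Proof.
move=> sf k; apply: Ck_matrix => // i l.
have H : Ck k U (fun x => \sum_a invmx (G x) l a * partial a f x).
  apply: Ck_sum => // a; apply: CkM => //; last exact: smooth_derive.
  exact: (smooth_entry oU l a (smooth_invmx oU sG unitG)).
by apply: Ck_eq oU _ H => x _; rewrite mxE.
Qed.

End ChartGeometry.

(** * Null frames *)

Section DualFrames.
Variables (R : fieldType) (n : nat) (G : 'M[R]_n).

(** The scalar product on a single tangent space: [inner G x] is
    [mx_form (G x)]. *)
Definition mx_form (u v : 'rV[R]_n) : R := (u *m G *m v^T) 0 0.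

Variables (q : 'I_n -> 'rV[R]_n) (s : 'I_n -> 'I_n).
Hypothesis s_involutive : involutive s.
Hypothesis gram_q : forall i j, mx_form (q i) (q j) = (s i == j)%:R.

Let Q : 'M[R]_n := \matrix_i q i.
Let S : 'M[R]_n := \matrix_(i, j) (s i == j)%:R.

Let mx_form_entry m (A : 'M[R]_(m, n)) i j : (A *m G *m Q^T) i j = mx_form (row i A) (q j).
Proof.
rewrite /mx_form -row_mul !mxE; apply: eq_bigr => k _.
by rewrite !mxE.
Qed.

Let mul_S m (A : 'M[R]_(m, n)) i j : (A *m S) i j = A i (s j).
Proof.
rewrite mxE (bigD1 (s j)) //= mxE s_involutive eqxx mulr1 big1 ?addr0 // => k.
by rewrite mxE (inv_eq s_involutive) => /negbTE ->; rewrite mulr0.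
Qed.

Let Q_inv : Q *m (G *m Q^T *m S) = 1%:M.
Proof.
apply/matrixP => i j; rewrite !mulmxA mul_S mx_form_entry rowK gram_q mxE.
by rewrite (inj_eq (inv_inj s_involutive)).
Qed.

(** The basis [q (s i)] is dual to [q i], which makes the coordinates of a vector
    in the frame, and the trace below, scalar products. *)
Lemma frame_expansion u : u = \sum_i mx_form u (q (s i)) *: q i.
Proof.
rewrite -[LHS]mulmx1 -(mulmx1C Q_inv) !mulmxA mulmx_sum_row.
by apply: eq_bigr => i _; rewrite mul_S mx_form_entry rowK row_id.
Qed.

Lemma frame_trace (A : 'M[R]_n) : \tr A = \sum_i mx_form (q i *m A) (q (s i)).
Proof.
rewrite -[A in LHS]mulmx1 -(mulmx1C Q_inv) mulmxA mxtrace_mulC !mulmxA.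
by apply: eq_bigr => i _; rewrite mul_S mx_form_entry row_mul rowK.
Qed.

End DualFrames.

(** The witnesses are the images of the first two basis vectors of R^3 under the
    rotation that takes the third one to [(n1, n2, n3)] and fixes the vectors
    orthogonal to both; this formula is singular only at the antipode [n3 = -1]. *)
Lemma orthonormal_completion (R : realFieldType) (n1 n2 n3 : R) :
  n1 * n1 + n2 * n2 + n3 * n3 = 1 ->
  exists a1 a2 a3 b1 b2 b3 : R,
  [/\ a1 * n1 + a2 * n2 + a3 * n3 = 0, b1 * n1 + b2 * n2 + b3 * n3 = 0,
      a1 * b1 + a2 * b2 + a3 * b3 = 0, a1 * a1 + a2 * a2 + a3 * a3 = 1 &
      b1 * b1 + b2 * b2 + b3 * b3 = 1].
Proof.
move=> unit_n; have [n3N|n3N] := eqVneq (1 + n3) 0.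
  have n3E : n3 = -1 by lra.
  have : n1 * n1 + n2 * n2 = 0 by rewrite n3E in unit_n; lra.
  move/eqP; rewrite -!expr2 paddr_eq0 ?sqr_ge0 // !sqrf_eq0.
  case/andP => /eqP -> /eqP ->.
  by exists 1, 0, 0, 0, 1, 0; split; ring.
pose k := (1 + n3)^-1.
have k1 : k * (1 + n3) = 1 by rewrite mulVf.
have k2 : k * (n1 * n1 + n2 * n2) = 1 - n3.
  have -> : n1 * n1 + n2 * n2 = (1 + n3) * (1 - n3) by lra.
  by rewrite mulrA k1 mul1r.
have k3 : 1 - 2 * k + k * (k * (n1 * n1 + n2 * n2)) = 0.
  by rewrite k2; lra.
exists (1 - n1 * n1 * k), (- (n1 * n2 * k)), (- n1),
  (- (n1 * n2 * k)), (1 - n2 * n2 * k), (- n2); split.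
- transitivity (n1 * (1 - n3 - k * (n1 * n1 + n2 * n2))); first by ring.
  by rewrite k2 subrr mulr0.
- transitivity (n2 * (1 - n3 - k * (n1 * n1 + n2 * n2))); first by ring.
  by rewrite k2 subrr mulr0.
- transitivity (n1 * n2 * (1 - 2 * k + k * (k * (n1 * n1 + n2 * n2)))); first by ring.
  by rewrite k3 mulr0.
- transitivity (1 + n1 * n1 * (1 - 2 * k + k * (k * (n1 * n1 + n2 * n2)))); first by ring.
  by rewrite k3 mulr0 addr0.
- transitivity (1 + n2 * n2 * (1 - 2 * k + k * (k * (n1 * n1 + n2 * n2)))); first by ring.
  by rewrite k3 mulr0 addr0.
Qed.

Definition row4 (R : Type) (a b c d : R) : 'rV[R]_4 := \row_j tnth [tuple a; b; c; d] j.

Lemma mx_form_minkowski (R : realType) (a b c d a' b' c' d' : R) :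
  mx_form (minkowski_mx R 4) (row4 a b c d) (row4 a' b' c' d') =
  - (a * a') + b * b' + c * c' + d * d'.
Proof.
rewrite /mx_form /minkowski_mx mul_mx_diag mxE !big_ord_recl big_ord0 !mxE /=.
by rewrite !(tnth_nth 0) /=; ring.
Qed.

Lemma row4_eta (R : realType) (v : 'rV[R]_4) :
  v = row4 (v 0 0) (v 0 1) (v 0 2) (v 0 3).
Proof.
apply/rowP => i; rewrite mxE (tnth_nth 0).
by case: i => [[|[|[|[|i]]]] Hi] //=; congr (v 0 _); exact: val_inj.
Qed.

(** In a null frame the two null vectors, numbered 0 and 1, are dual to each other
    and the two unit vectors are self-dual. *)
Definition null_swap (i : 'I_4) : 'I_4 := tnth [tuple 1; 0; 2; 3] i.

(** In an orthonormal basis [V] is [a] times [(1, n)] with [n] a unit vector of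
    R^3.  The other null vector is a multiple of [(-1, n)], and the unit vectors
    are an orthonormal basis of the plane orthogonal to [n]. *)
Lemma null_frame (R : realType) (G : 'M[R]_4) (V : 'rV[R]_4) :
  lorentzian_mx G -> V <> 0 -> mx_form G V V = 0 ->
  exists2 q : 'I_4 -> 'rV[R]_4, q 0 = V &
    forall i j, mx_form G (q i) (q j) = (null_swap i == j)%:R.
Proof.
move=> [symG [P uP GP]] V0 VV.
have formP u v : mx_form G (u *m P) (v *m P) = mx_form (minkowski_mx R 4) u v.
  by rewrite /mx_form trmx_mul -GP !mulmxA.
have formC u v : mx_form (minkowski_mx R 4) u v = mx_form (minkowski_mx R 4) v u.
  by rewrite (row4_eta u) (row4_eta v) !mx_form_minkowski; ring.
have [v VE] : exists v, V = v *m P by exists (V *m invmx P); rewrite mulmxKV.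
rewrite VE formP in VV; subst V.
have v0 : v <> 0 by move=> v0; apply: V0; rewrite v0 mul0mx.
move: VV v0 {V0}; rewrite (row4_eta v).
move: (v 0 0) (v 0 1) (v 0 2) (v 0 3) => a b c d {v}.
rewrite mx_form_minkowski => VV v0.
have a0 : a != 0.
  apply/eqP => a0; apply: v0; rewrite a0 in VV *.
  have : b ^+ 2 + c ^+ 2 + d ^+ 2 = 0 by rewrite !expr2 -VV; ring.
  move/eqP; rewrite !paddr_eq0 ?addr_ge0 ?sqr_ge0 // !sqrf_eq0.
  case/andP => /andP[/eqP -> /eqP ->] /eqP ->.
  by apply/rowP => i; rewrite !mxE (tnth_nth 0); case: i => [[|[|[|[|i]]]] Hi].
have unit_n : b / a * (b / a) + c / a * (c / a) + d / a * (d / a) = 1.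
  have E : b * b + c * c + d * d = a * a by apply/eqP; rewrite -subr_eq0 -VV; apply/eqP; ring.
  transitivity ((b * b + c * c + d * d) / (a * a)); first by field.
  by rewrite E divff // mulf_neq0.
have [e1 [e2 [e3 [f1 [f2 [f3 [en fn ef ee ff]]]]]]] := orthonormal_completion unit_n.
pose r0 := row4 a b c d.
(* The factor [(2 * a)^-1] normalizes the product of [r0] and [r1] to 1. *)
pose r1 := row4 (- (2 * a)^-1) (b / a / (2 * a)) (c / a / (2 * a)) (d / a / (2 * a)).
pose r2 := row4 0 e1 e2 e3; pose r3 := row4 0 f1 f2 f3.
exists (fun i => tnth [tuple r0; r1; r2; r3] i *m P); first by rewrite (tnth_nth 0).
have g01 : mx_form (minkowski_mx R 4) r0 r1 = 1.
  rewrite mx_form_minkowski.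
  transitivity ((1 + (b / a * (b / a) + c / a * (c / a) + d / a * (d / a))) / 2).
    by field.
  by rewrite unit_n; field.
have g11 : mx_form (minkowski_mx R 4) r1 r1 = 0.
  rewrite mx_form_minkowski.
  transitivity (((b / a * (b / a) + c / a * (c / a) + d / a * (d / a)) - 1) / (4 * (a * a))).
    by field.
  by rewrite unit_n subrr mul0r.
have g02 : mx_form (minkowski_mx R 4) r0 r2 = 0.
  rewrite mx_form_minkowski -[RHS](mulr0 a) -[in RHS]en; by field.
have g03 : mx_form (minkowski_mx R 4) r0 r3 = 0.
  rewrite mx_form_minkowski -[RHS](mulr0 a) -[in RHS]fn; by field.
have g12 : mx_form (minkowski_mx R 4) r1 r2 = 0.
  rewrite mx_form_minkowski -[RHS](mul0r (2 * a)^-1) -[in RHS]en; by field.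
have g13 : mx_form (minkowski_mx R 4) r1 r3 = 0.
  rewrite mx_form_minkowski -[RHS](mul0r (2 * a)^-1) -[in RHS]fn; by field.
have g22 : mx_form (minkowski_mx R 4) r2 r2 = 1 by rewrite mx_form_minkowski -[RHS]ee; ring.
have g33 : mx_form (minkowski_mx R 4) r3 r3 = 1 by rewrite mx_form_minkowski -[RHS]ff; ring.
have g23 : mx_form (minkowski_mx R 4) r2 r3 = 0 by rewrite mx_form_minkowski -[RHS]ef; ring.
have g00 : mx_form (minkowski_mx R 4) r0 r0 = 0 by rewrite mx_form_minkowski.
move=> i j; rewrite formP /null_swap !(tnth_nth 0).
case: i => [[|[|[|[|i]]]] Hi] //; case: j => [[|[|[|[|j]]]] Hj] //=;
by rewrite ?(g00, g01, g02, g03, g11, g12, g13, g22, g23, g33) //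
     formC ?(g01, g02, g03, g12, g13, g23).
Qed.

(** * Algebraic curvature tensors annihilated by a null vector *)

Lemma ord4_ind (P : 'I_4 -> Prop) : P 0 -> P 1 -> P 2 -> P 3 -> forall i, P i.
Proof.
move=> P0 P1 P2 P3 [[|[|[|[|i]]]] Hi] //;
  [move: P0|move: P1|move: P2|move: P3]; congr P; exact: val_inj.
Qed.

Section AlgebraicCurvature.
Variables (R : realType) (n : nat) (G : 'M[R]_n).
Variable Rm : 'rV[R]_n -> 'rV[R]_n -> 'rV[R]_n -> 'rV[R]_n.
Hypothesis Rm_linear1 : forall a u v w z,
  Rm (a *: u + v) w z = a *: Rm u w z + Rm v w z.
Hypothesis Rm_antisym : forall u v w, Rm u v w = - Rm v u w.
Hypothesis Rm_skew : forall u v w z, mx_form G (Rm u v w) z = - mx_form G (Rm u v z) w.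
Hypothesis Rm_Bianchi : forall u v w, Rm u v w + Rm v w u + Rm w u v = 0.

Lemma mx_formDl u v w : mx_form G (u + v) w = mx_form G u w + mx_form G v w.
Proof. by rewrite /mx_form !mulmxDl mxE. Qed.

Lemma mx_formNl u w : mx_form G (- u) w = - mx_form G u w.
Proof. by rewrite /mx_form !mulNmx mxE. Qed.

Lemma mx_form0l w : mx_form G 0 w = 0.
Proof. by rewrite /mx_form !mul0mx mxE. Qed.

(** The symmetry under exchange of the two pairs of arguments follows, as for any
    curvature tensor, from four instances of the Bianchi identity. *)
Lemma pair_symmetry a b c d : mx_form G (Rm a b c) d = mx_form G (Rm c d a) b.
Proof.
pose r u v w z := mx_form G (Rm u v w) z; rewrite -/(r a b c d) -/(r c d a b).
have A12 u v w z : r u v w z = - r v u w z by rewrite /r Rm_antisym mx_formNl.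
have A34 u v w z : r u v w z = - r u v z w by exact: Rm_skew.
have B u v w z : r u v w z + r v w u z + r w u v z = 0.
  by rewrite /r -!mx_formDl Rm_Bianchi mx_form0l.
have := (B a b c d, B b c d a, B c d a b, B d a b c).
have := (A34 a b d c, A34 c d b a, A34 b c d a, A34 d a c b, A12 c a b d, A34 a c d b).
have := (A12 d b c a, A34 b d c a).
by move=> [? ?] [[[[[? ?] ?] ?] ?] ?] [[[? ?] ?] ?]; lra.
Qed.

Lemma linear_sum0 (f : 'rV[R]_n -> 'rV[R]_n) m (c : 'I_m -> R) (q : 'I_m -> 'rV[R]_n) :
  (forall a u v, f (a *: u + v) = a *: f u + f v) ->
  (forall i, c i *: f (q i) = 0) -> f (\sum_i c i *: q i) = 0.
Proof.
move=> lin_f fq0; pose L : {linear 'rV[R]_n -> 'rV[R]_n} :=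
  HB.pack f (GRing.isLinear.Build R _ _ _ f lin_f).
rewrite -[f]/(L : _ -> _) linear_sum big1 // => i _; rewrite linearZ; exact: fq0.
Qed.

Lemma Rm_trace u v : \tr (\matrix_a Rm (delta_mx 0 a) u v) = \sum_a Rm (delta_mx 0 a) u v 0 a.
Proof. by apply: eq_bigr => a _; rewrite !mxE. Qed.

Lemma Rm_mx w u v : w *m (\matrix_a Rm (delta_mx 0 a) u v) = Rm w u v.
Proof.
pose f w := Rm w u v; have lin_f a x y : f (a *: x + y) = a *: f x + f y.
  exact: Rm_linear1.
pose L : {linear 'rV[R]_n -> 'rV[R]_n} :=
  HB.pack f (GRing.isLinear.Build R _ _ _ f lin_f).
rewrite -[RHS]/(L w) -mul_rV_lin1; congr (_ *m _).
by apply/matrixP => i j; rewrite !mxE.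
Qed.

End AlgebraicCurvature.

(** Take a null frame [V, U, E, F].  Every component of the curvature with an
    entry [V] vanishes, so the trace defining [Ricci u v] reduces to the terms in
    [E] and [F].  Evaluated on [(F, F)], [(F, U)] and [(E, U)] each sum has only
    one term left, and these three are, up to sign, all the components of
    [R(E, F)] that could be nonzero.  Since the hyperplane orthogonal to [V] is
    spanned by [V], [E] and [F], nothing else enters the conclusion. *)
Lemma Ricci_flat_null_hyperplane (R : realType) (G : 'M[R]_4) Rm (V : 'rV[R]_4) :
  lorentzian_mx G ->
  (forall a u v w z, Rm (a *: u + v) w z = a *: Rm u w z + Rm v w z) ->
  (forall a u v w z, Rm w z (a *: u + v) = a *: Rm w z u + Rm w z v) ->
  (forall u v w, Rm u v w = - Rm v u w) ->
  (forall u v w z, mx_form G (Rm u v w) z = - mx_form G (Rm u v z) w) ->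
  (forall u v w, Rm u v w + Rm v w u + Rm w u v = 0) ->
  (forall u v, \sum_a Rm (delta_mx 0 a) u v 0 a = 0) ->
  V <> 0 -> mx_form G V V = 0 ->
  (forall u v w, mx_form G (Rm u v w) V = 0) ->
  forall u v w, mx_form G u V = 0 -> mx_form G v V = 0 -> Rm u v w = 0.
Proof.
move=> lorG lin1 lin3 asym skew bianchi ric V0 VV RV X Y w XV YV.
have [q q0 gram] := null_frame lorG V0 VV.
have inv_swap : involutive null_swap.
  by case=> [[|[|[|[|i]]]] Hi] //; apply: val_inj; rewrite /null_swap !(tnth_nth 0).
have s0 : null_swap 0 = 1 by exact: val_inj.
have s1 : null_swap 1 = 0 by exact: val_inj.
have s2 : null_swap 2 = 2 by exact: val_inj.
have s3 : null_swap 3 = 3 by exact: val_inj.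
have expand := frame_expansion inv_swap gram.
have psym := pair_symmetry asym skew bianchi.
(* The frame vectors [V, U, E, F] are numbered 0, 1, 2, 3. *)
pose r a b c d := mx_form G (Rm (q a) (q b) (q c)) (q d).
have rV4 a b c : r a b c 0 = 0 by rewrite /r q0.
have rV3 a b d : r a b 0 d = 0 by rewrite /r skew -/(r a b d 0) rV4 oppr0.
have rV2 a c d : r a 0 c d = 0 by rewrite /r psym -/(r c d a 0) rV4.
have ricq b c : r 2 b c 2 + r 3 b c 3 = 0.
  have := ric (q b) (q c); rewrite -Rm_trace (frame_trace inv_swap gram).
  under eq_bigr do rewrite (Rm_mx lin1).
  have o1 : lift ord0 ord0 = 1 :> 'I_4 by exact: val_inj.
  have o2 : lift ord0 (lift ord0 ord0) = 2 :> 'I_4 by exact: val_inj.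
  have o3 : lift ord0 (lift ord0 (lift ord0 ord0)) = 3 :> 'I_4 by exact: val_inj.
  rewrite !big_ord_recl big_ord0 addr0 o1 o2 o3 [ord0]/(0 : 'I_4) s0 s1 s2 s3.
  rewrite -/(r 0 b c 1) -/(r 1 b c 0) -/(r 2 b c 2) -/(r 3 b c 3) rV4 add0r.
  by rewrite /r psym -/(r c 1 0 b) rV3 add0r.
have raa a c d : r a a c d = 0.
  have := congr1 (fun z => mx_form G z (q d)) (asym (q a) (q a) (q c)).
  rewrite mx_formNl -/(r a a c d); lra.
have rcc a b c : r a b c c = 0 by have := skew (q a) (q b) (q c) (q c); rewrite -/(r a b c c); lra.
have r34 a b c d : r a b c d = - r a b d c by exact: skew.
have r12 a b c d : r a b c d = - r b a c d by rewrite /r asym mx_formNl.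
have R2332 : r 2 3 3 2 = 0 by have := ricq 3 3; rewrite raa addr0.
have R2312 : r 2 3 1 2 = 0 by have := ricq 3 1; rewrite raa addr0.
have R2313 : r 2 3 1 3 = 0.
  by have := ricq 2 1; rewrite raa add0r r12 => /eqP; rewrite oppr_eq0 => /eqP.
have R23 c d : r 2 3 c d = 0.
  elim/ord4_ind: c; elim/ord4_ind: d;
    rewrite ?(rV3, rV4, rcc, R2332, R2312, R2313) //;
      by rewrite r34 ?(R2332, R2312, R2313) oppr0.
have vanish u : (forall j, mx_form G u (q j) = 0) -> u = 0.
  by move=> uq; rewrite (expand u) big1 // => i _; rewrite uq scale0r.
have Rm_V b z : Rm V b z = 0.
  by apply: vanish => j; rewrite psym skew RV oppr0.
have Rm23 z : Rm (q 2) (q 3) z = 0.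
  rewrite (expand z); apply: (linear_sum0 (f := Rm (q 2) (q 3))) => [a u v|i]; first exact: lin3.
  by rewrite (vanish (Rm _ _ _)) ?scaler0 // => j; exact: R23.
have Rm_self u z : Rm u u z = 0.
  apply: vanish => j; have := congr1 (fun t => mx_form G t (q j)) (asym u u z).
  by rewrite mx_formNl; lra.
have Rm_frame i j z : i != 1 -> j != 1 -> Rm (q i) (q j) z = 0.
  elim/ord4_ind: i; elim/ord4_ind: j => // _ _; rewrite ?q0 ?Rm_V ?Rm_self //.
  - by rewrite asym Rm_V oppr0.
  - by rewrite asym Rm_V oppr0.
  - by rewrite asym Rm23 oppr0.
have perp (f : 'rV[R]_4 -> 'rV[R]_4) u : (forall a x y, f (a *: x + y) = a *: f x + f y) ->
    mx_form G u V = 0 -> (forall i, i != 1 -> f (q i) = 0) -> f u = 0.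
  move=> lin_f uV fq; rewrite (expand u); apply: (linear_sum0 (f := f)) => // i.
  have [->|/fq ->] := eqVneq i 1; last by rewrite scaler0.
  by rewrite s1 q0 uV scale0r.
apply: (perp (fun x => Rm x Y w)) => // i i1.
apply: (perp (fun y => Rm (q i) y w)) => // [a x y|j j1].
  by rewrite asym lin1 [Rm x _ _]asym [Rm y _ _]asym scalerN -opprD opprK.
exact: Rm_frame.
Qed.

(** * Functions with pure trace Hessian and null gradient *)

(** Differentiating [g (grad f, grad f) = 0] along [u] gives
    [2 * Hes f (u, grad f) = 2 * c * g (u, grad f) = 0] for all [u].  As the
    gradient does not vanish, [c] does, and then so does the Hessian. *)
Lemma null_gradient_parallel (R : realType) n (G : 'rV[R]_n -> 'M[R]_n) U f (c : 'rV[R]_n -> R) :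
  open U -> smooth_on U G -> (forall x, U x -> (G x)^T = G x) ->
  (forall x, U x -> G x \in unitmx) -> smooth_on U f ->
  (forall x u v, U x -> Hes G f x u v = c x * inner G x u v) ->
  (forall x, U x -> grad G f x <> 0) ->
  (forall x, U x -> inner G x (grad G f x) (grad G f x) = 0) ->
  forall x u, U x -> nabla G (cst u) (grad G f) x = 0.
Proof.
move=> oU sG symG uG sf hess grad0 null x u Ux.
have dgrad := smooth_differentiable (smooth_grad oU sG uG sf) Ux.
have c_null v : c x * inner G x v (grad G f x) = 0.
  have := derive_inner oU sG symG uG v Ux dgrad dgrad.
  rewrite [X in _ = _ + X](inner_sym symG _ _ Ux) -/(Hes G f x v (grad G f x)) hess //.
  rewrite (@near_eq_derive _ _ _ _ (cst 0)); last by apply: (open_near oU Ux) => y; exact: null.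
  by rewrite derive_cst; lra.
have c0 : c x = 0.
  apply/eqP/negP => /negP c0; apply: (grad0 x Ux).
  apply: (inner_nondegenerate uG Ux) => v; rewrite (inner_sym symG _ _ Ux).
  by apply: (mulfI c0); rewrite c_null mulr0.
apply: (inner_nondegenerate uG Ux) => v.
by rewrite -/(Hes G f x u v) hess // c0 mul0r.
Qed.

(** * The gradient as a vector field on the manifold *)

Section LorentzianMatrices.
Variables (R : realType) (n : nat) (G : 'M[R]_n).

Lemma minkowski_unitmx : minkowski_mx R n \in unitmx.
Proof.
rewrite unitmxE unitfE det_diag; apply/prodf_neq0 => j _.
by rewrite mxE; case: ifP => _; rewrite ?oppr_eq0 oner_eq0.
Qed.

Lemma lorentzian_unitmx : lorentzian_mx G -> G \in unitmx.
Proof.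
move=> [_ [P _ GP]]; have := minkowski_unitmx.
by rewrite -GP !unitmx_mul => /andP[/andP[]].
Qed.

End LorentzianMatrices.

Section Transitions.
Variables (R : realType) (n : nat) (M : manifold R n).
Implicit Types (i j : chart_index M) (x v : 'rV[R]_n).

Lemma overlap_sub i j x : overlap i j x -> cod i x /\ cod j (transition i j x).
Proof.
move=> [p [ip jp] <-]; split; first by exists p.
by exists p => //; rewrite /transition /= phiK.
Qed.

Lemma overlap_open i j : open (overlap i j).
Proof.
have -> : overlap i j = cod i `&` psi i @^-1` dom j.
  apply/seteqP; split=> [x [p [ip jp] <-]|x [[p ip <-]]] /=.
    by split; [exists p|rewrite phiK].
  by rewrite phiK // => jp; exists p.
by apply: (continuous_inP _ _).1; [exact: cod_open| |exact: dom_open];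
  rewrite -continuous_open_subspace; [exact: psi_continuous|exact: cod_open].
Qed.

Lemma local_rep_transition (h : M -> R) i j x : overlap i j x ->
  local_rep h i x = local_rep h j (transition i j x).
Proof.
by move=> [p [ip jp] <-]; rewrite /local_rep /transition /= !phiK.
Qed.

(** The differential of a function is intrinsic: this is the chain rule for the
    change of coordinates. *)
Lemma derive_local_rep (h : M -> R) i j x v : smooth_function h -> overlap i j x ->
  'D_v (local_rep h i) x =
  'D_(v *m 'J (transition i j) x) (local_rep h j) (transition i j x).
Proof.
move=> sh xij; have [xi xj] := overlap_sub xij.
have dt : differentiable (transition i j) x.
  exact: smooth_differentiable (transition_smooth i j) xij.
have dh : differentiable (local_rep h j) (transition i j x).
  exact: smooth_differentiable (sh j) xj.
have -> : 'D_v (local_rep h i) x = 'D_v (local_rep h j \o transition i j) x.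
  apply: near_eq_derive; apply: (open_near (@overlap_open i j) xij) => y.
  exact: local_rep_transition.
rewrite (deriveE _ (differentiable_comp dt dh)) (deriveE _ dh).
have <- : 'd (transition i j) x v = v *m 'J (transition i j) x.
  by rewrite -(deriveE v dt) (deriveEjacobian v dt).
have := diff_comp dt dh => /(congr1 (fun F => F v)); apply.
Qed.

End Transitions.

Section Gradient.
Variables (R : realType) (n : nat) (M : spacetime R n).
Implicit Types (i j : chart_index M) (x v : 'rV[R]_n).

Let sym_metric i x : cod i x -> (metric i x)^T = metric i x.
Proof. by move=> /metric_lorentzian[]. Qed.

Let unit_metric i x : cod i x -> metric i x \in unitmx.
Proof. by move=> /metric_lorentzian/lorentzian_unitmx. Qed.

(** The transformation law of the gradient is obtained by duality: in both charts
    the gradient represents the differential with respect to the metric, and the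
    laws of the differential and of the metric are known. *)
Lemma smooth_gradient (h : M -> R) : smooth_function h ->
  smooth_vector_field (gradient h).
Proof.
move=> sh; split=> [i|i j x xij].
  by apply: smooth_grad => //; [exact: cod_open|exact: metric_smooth|exact: unit_metric].
have [xi xj] := overlap_sub xij.
set J := 'J (transition i j) x; set y := transition i j x.
have GJ : metric i x = J *m metric j y *m J^T by exact: metric_transition.
have uJ : J \in unitmx.
  by have := unit_metric xi; rewrite GJ !unitmx_mul => /andP[/andP[]].
apply/eqP; rewrite -subr_eq0; apply/eqP.
apply: (inner_nondegenerate (@unit_metric j) xj) => z.
have := derive_local_rep (z *m invmx J) sh xij; rewrite -/J mulmxKV //.
rewrite -(inner_grad (@sym_metric i) (@unit_metric i) _ xi); last first.
  exact: smooth_differentiable (sh i) xi.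
rewrite -(inner_grad (@sym_metric j) (@unit_metric j) _ xj); last first.
  exact: smooth_differentiable (sh j) xj.
rewrite innerBl => <-; apply/eqP; rewrite subr_eq0; apply/eqP.
rewrite /inner /gradient GJ trmx_mul trmx_inv !mulmxA mulmxK //.
by rewrite unitmx_tr.
Qed.

Lemma isotropic_gradient_parallel (h : M -> R) (Lambda : R) : smooth_function h ->
  ricci_flat M -> isotropic_solution h Lambda -> parallel (gradient h).
Proof.
move=> sh flat [eq null] i x u xi.
pose G := @metric R n M i; pose f := local_rep h i.
apply: (@null_gradient_parallel _ _ G (cod i) f (fun x => laplacian G f x + Lambda)).
- exact: cod_open.
- exact: metric_smooth.
- exact: (@sym_metric i).
- exact: (@unit_metric i).
- exact: sh i.
- move=> y a b yi; have := eq i y a b yi; rewrite /= flat // mulr0 -/G -/f; lra.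
- by move=> y /null[].
- by move=> y /null[].
- exact: xi.
Qed.

End Gradient.

Theorem theorem5p1 (R : realType) (M : spacetime R 4) (h : M -> R) (Lambda : R)
  (M_ricci_flat : ricci_flat M)
  (h_smooth : smooth_function h)
  (h_pos : forall p : M, 0 < h p)
  (h_nonconst : forall O : set M, open O -> O !=set0 ->
     ~ (exists c : R, forall p : M, O p -> h p = c))
  (h_sol : isotropic_solution h Lambda) :
  pp_wave M.
Proof.
have sV := smooth_gradient h_smooth.
have pV := isotropic_gradient_parallel h_smooth M_ricci_flat h_sol.
have lV := h_sol.2.
exists (gradient h); split=> // i x u v xi uV vV w.
have [V0 VV] := lV i x xi.
have oU : open (cod i) by exact: cod_open.
have sG : smooth_on (cod i) (metric i) by exact: metric_smooth.
have symG y : cod i y -> (metric i y)^T = metric i y by case/metric_lorentzian.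
have uG y : cod i y -> metric i y \in unitmx by move/metric_lorentzian/lorentzian_unitmx.
have sVi : smooth_on (cod i) (gradient h i) by exact: sV.1.
apply: (Ricci_flat_null_hyperplane (metric_lorentzian xi) _ _ _ _ _ _ V0 VV) => //.
- by move=> *; exact: (Riem_linear1 oU sG uG _ _ _ _ _ xi).
- by move=> *; exact: (Riem_linear3 oU sG uG _ _ _ _ _ xi).
- by move=> *; exact: Riem_antisym.
- by move=> *; exact: (Riem_skew oU sG symG uG _ _ _ _ xi).
- by move=> *; exact: (Riem_Bianchi oU symG _ _ _ xi).
- by move=> a b; exact: M_ricci_flat.
- move=> a b c; apply: (Riem_parallel oU sG symG uG a b c xi sVi).
  by move=> y a' yi; exact: pV.
Qed.
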